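(* Let $m\in\mathbb{N}\setminus\{0,1\}$. Let $\widehat U_1:\mathcal{X}\to\mathcal{X}\times\mathcal{X}$ be given either by $\widehat U_1b=U_1(0,b)$ (case 1) or by $\widehat U_1b=U_1(b,b)$ (case 2). For every $n\in\{1,\ldots,m-1\}$ and $i\in\{2,\ldots,n\}$, let $$a_{i,n}=\frac12\sup_{p\in\mathbb{N}}\left(\beta_{i,n,p}^2+\widetilde\beta_{i,n,p}^2+\eta_{i,n}^2+\sqrt{(\beta_{i,n,p}^2+\widetilde\beta_{i,n,p}^2+\eta_{i,n}^2)^2-4\beta_{i,n,p}^2\eta_{i,n}^2}\right),$$ and for $i\in\{2,\ldots,m\}$ let $\overline a_{i,m}=\sup_{p}(\beta_{i,m,p}^2+\widetilde\beta_{i,m,p}^2)$. For $n\in\{1,\ldots,m-1\}$ let $\widehat a_{1,n}=(\sup_p\widetilde\beta_{1,n,p}^2)+\eta_{1,n}^2$ in case 1 and $\widehat a_{1,n}=(\sup_p(\beta_{1,n,p}+\widetilde\beta_{1,n,p})^2)+\eta_{1,n}^2$ in case 2; let $\widehat a_{1,m}=\sup_p\widetilde\beta_{1,m,p}^2$ in case 1 and $\widehat a_{1,m}=\sup_p(\beta_{1,m,p}+\widetilde\beta_{1,m,p})^2$ in case 2. Define recursively $$\widehat\theta_n=\sqrt{\widehat a_{1,n}}+\sum_{i=2}^n\widehat\theta_{i-1}\sqrt{a_{i,n}}\quad(n\in\{1,\ldots,m-1\}),\qquad \widehat\theta_m=\sqrt{\widehat a_{1,m}}+\sum_{i=2}^m\widehat\theta_{i-1}\sqrt{\overline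 a_{i,m}}.$$ Let $\alpha\in[1/2,1]$ and $$\widehat b_\alpha=\begin{cases}\sup_p\big(\widetilde\beta_{1,m,p}-2^m(1-\alpha)\big)^2&\text{in case 1,}\\ \sup_p\big(\beta_{1,m,p}+\widetilde\beta_{1,m,p}-2^m(1-\alpha)\big)^2&\text{in case 2.}\end{cases}$$ In each case, if $$\sqrt{\widehat b_\alpha}-\sqrt{\widehat a_{1,m}}\le 2^m\alpha-2\widehat\theta_m,$$ then the network $$R_m\circ\overline U_m\circ Q_{m-1}\circ U_{m-1}\circ\cdots\circ Q_2\circ U_2\circ Q_1\circ\widehat U_1:\mathcal{X}\to\mathcal{X}$$ is $\alpha$-averaged.
   Context: $\mathcal{X},\mathcal{Y}$ are real Hilbert spaces of functions on $]0,1[$ (typically $L^2(0,1)$); $T:\mathcal{X}\to\mathcal{Y}$ is a compact linear integral operator $(Tx)(t)=\int_0^1 k(t,s)x(s)\,ds$ with $k\in L^2([0,1]^2)$; $D$ is a bounded linear operator from $\mathcal{X}$ to a real Hilbert space. $T^*T$ and $D^*D$ commute and are diagonalized in a common orthonormal basis $(v_p)_{p\in\mathbb{N}}$ of $\mathcal{X}$, with eigenvalues $(\beta_{T,p})_p$ and $(\beta_{D,p})_p$ respectively. $g:\mathcal{X}\to\,]-\infty,+\infty]$ is proper, lower semicontinuous and convex. For $n\in\{1,\ldots,m\}$, $\lambda_n,\mu_n,\tau_n,\eta_n$ are positive reals. $\mathrm{Id}$ is the identity. The proximity operator is $\mathrm{prox}_{f}(x)=\operatorname{argmin}_{y}\,(f(y)+\frac12\|x-y\|^2)$.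 $R_n=\mathrm{prox}_{\lambda_n\mu_ng}$, $W_n=\mathrm{Id}-\lambda_nT^*T-\lambda_n\tau_nD^*D$ on $\mathcal{X}$. On $\mathcal{X}\times\mathcal{X}$, with norm $\|(x,b)\|=\sqrt{\|x\|^2+\|b\|^2}$: $U_n(x,b)=(W_nx+\lambda_nb,\ \eta_nb)$ and $Q_n(x,b)=(R_nx,\ b)$. $\overline U_m:\mathcal{X}\times\mathcal{X}\to\mathcal{X}$, $\overline U_m(x,b)=W_mx+\lambda_mb$. For $1\le i\le n\le m$ and $p\in\mathbb{N}$: $\beta_p^{(n)}=1-\lambda_n(\beta_{T,p}+\tau_n\beta_{D,p})$; $\beta_{i,n,p}=\prod_{j=i}^n\beta_p^{(j)}$; $\eta_{i,j}=\eta_j\cdots\eta_i$ if $j\ge i$ and $\eta_{i,j}=1$ otherwise; $\widetilde\beta_{i,n,p}=\sum_{j=i}^{n-1}\beta_p^{(n)}\cdots\beta_p^{(j+1)}\lambda_j\eta_{i,j-1}+\lambda_n\eta_{i,n-1}$ (an empty sum is $0$). An operator $S:\mathcal{H}\to\mathcal{H}$ on a Hilbert space is $\alpha$-averaged if $S=(1-\alpha)\mathrm{Id}+\alpha R$ for some nonexpansive (1-Lipschitz) $R:\mathcal{H}\to\mathcal{H}$ (for $\alpha=1$ this means $S$ is nonexpansive). *)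

(* Defs.v *)
From HB Require Import structures.
From mathcomp Require Import all_boot all_order all_algebra.
From mathcomp Require Import all_classical all_reals all_analysis.

Set Implicit Arguments.
Unset Strict Implicit.
Unset Printing Implicit Defensive.

Import Order.TTheory GRing.Theory Num.Theory.
Import numFieldNormedType.Exports.

Local Open Scope classical_set_scope.
Local Open Scope ring_scope.

HB.mixin Record CompleteNormedModule_isHilbert (R : realType) H
    of CompleteNormedModule R H := {
  inner : {dot H for (@idfun R)} ;
  sqr_norm_inner : forall x : H, `|x| ^+ 2 = inner x x
}.

#[short(type="hilbertType")]
HB.structure Definition Hilbert (R : realType) :=
  {H of CompleteNormedModule R H & CompleteNormedModule_isHilbert R H}.

Section Operators.
Context {R : realType}.

Definition bounded_operator (H K : hilbertType R) (A : H -> K) : Prop :=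
  exists M : R, forall x, `|A x| <= M * `|x|.

Definition compact_operator (H K : hilbertType R) (A : H -> K) : Prop :=
  forall B : set H, bounded_set B -> precompact (A @` B).

(* The Hilbert space adjoint. By the Riesz theorem the set below is a singleton
   whenever A is linear and bounded. *)
Definition adjoint (H K : hilbertType R) (A : H -> K) (y : K) : H :=
  xget 0 [set x : H | forall z : H, inner (A z) y = inner z x].

Definition orthonormal_basis (H : hilbertType R) (v : nat -> H) : Prop :=
  (forall p q, inner (v p) (v q) = (p == q)%:R) /\
  dense [set x : H | exists (n : nat) (c : nat -> R),
                       x = \sum_(p < n) c p *: v p].

Definition averaged (H : hilbertType R) (alpha : R) (S : H -> H) : Prop :=
  exists2 N : H -> H, 1.-lipschitz N &
    forall x, S x = (1 - alpha) *: x + alpha *: N x.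

End Operators.

Section Prox.
Context {R : realType} {H : hilbertType R}.
Local Open Scope ereal_scope.

Definition proper_fun (f : H -> \bar R) : Prop :=
  (forall x, f x != -oo) /\ exists x, f x < +oo.

Definition convex_fun (f : H -> \bar R) : Prop :=
  forall (x y : H) (t : R), (0 < t < 1)%R ->
    f (t *: x + (1 - t)%R *: y)%R <= t%:E * f x + (1 - t)%:E * f y.

(* The set below is a singleton whenever f is proper, lower semicontinuous and
   convex. *)
Definition prox (f : H -> \bar R) (x : H) : H :=
  xget x [set y : H | forall z : H,
    f y + (2^-1 * `|x - y| ^+ 2)%:E <= f z + (2^-1 * `|x - z| ^+ 2)%:E].

End Prox.

Section FunctionSpaces.
Context {R : realType}.
Let openI : set R := `]0, 1[.
Let closedI : set R := `[0, 1].
Let mu : {measure set (measurableTypeR R) -> \bar R} := lebesgue_measure.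

(* H is a space of functions on ]0,1[, identified when they are equal almost
   everywhere: phi x is a representative of the element x of H. *)
Definition function_space (H : hilbertType R) (phi : H -> R -> R) : Prop :=
  [/\ forall x, measurable_fun openI (phi x),
      forall (a : R) (x y : H), {ae mu, forall t : R, openI t ->
        phi (a *: x + y) t = a * phi x t + phi y t} &
      forall x y : H, {ae mu, forall t : R, openI t ->
        phi x t = phi y t} -> x = y].

Definition L2_kernel (k : R * R -> R) : Prop :=
  measurable_fun (closedI `*` closedI)
    (k : measurableTypeR R * measurableTypeR R -> measurableTypeR R) /\
  (\int[mu \x mu]_(z in closedI `*` closedI) (k z ^+ 2)%:E < +oo)%E.

Definition integral_operator (H K : hilbertType R) (phi : H -> R -> R)
    (psi : K -> R -> R) (k : R * R -> R) (A : H -> K) : Prop :=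
  forall x : H, {ae mu, forall t : R, openI t ->
    mu.-integrable openI (fun s => (k (t, s) * phi x s)%:E) /\
    psi (A x) t = \int[mu]_(s in openI) (k (t, s) * phi x s)}.

End FunctionSpaces.

Section Network.
Context {R : realType} {X Y Z : hilbertType R}.
Variables (T : X -> Y) (D : X -> Z) (g : X -> \bar R).
Variables lambda mu tau eta : nat -> R.

Definition R_layer (n : nat) : X -> X :=
  prox (fun x => ((lambda n * mu n)%:E * g x)%E).

Definition W_layer (n : nat) (x : X) : X :=
  x - lambda n *: adjoint T (T x) - (lambda n * tau n) *: adjoint D (D x).

Definition U_layer (n : nat) (z : X * X) : X * X :=
  (W_layer n z.1 + lambda n *: z.2, eta n *: z.2).

Definition Q_layer (n : nat) (z : X * X) : X * X := (R_layer n z.1, z.2).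

Definition Ubar (m : nat) (z : X * X) : X :=
  W_layer m z.1 + lambda m *: z.2.

Variant first_layer_case := case1 | case2.

Definition Uhat1 (c : first_layer_case) (b : X) : X * X :=
  match c with
  | case1 => U_layer 1 (0, b)
  | case2 => U_layer 1 (b, b)
  end.

(* [iota 2 (m - 2)] is [:: 2; ...; m - 1]. *)
Definition network (c : first_layer_case) (m : nat) (b : X) : X :=
  R_layer m (Ubar m
    (foldl (fun z n => Q_layer n (U_layer n z)) (Q_layer 1 (Uhat1 c b))
       (iota 2 (m - 2)))).

End Network.

Section Coefficients.
Context {R : realType}.
Variables (lambda tau eta : nat -> R) (betaT betaD : nat -> R).

Definition beta_layer (n p : nat) : R :=
  1 - lambda n * (betaT p + tau n * betaD p).

Definition beta (i n p : nat) : R := \prod_(i <= j < n.+1) beta_layer j p.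

Definition eta_prod (i j : nat) : R := \prod_(i <= l < j.+1) eta l.

Definition betatilde (i n p : nat) : R :=
  \sum_(i <= j < n)
     (\prod_(j.+1 <= l < n.+1) beta_layer l p) * lambda j * eta_prod i j.-1
  + lambda n * eta_prod i n.-1.

Definition a_coef (i n : nat) : R :=
  2^-1 * sup (range (fun p =>
    let s := beta i n p ^+ 2 + betatilde i n p ^+ 2 + eta_prod i n ^+ 2 in
    s + Num.sqrt (s ^+ 2 - 4 * beta i n p ^+ 2 * eta_prod i n ^+ 2))).

Definition abar (i m : nat) : R :=
  sup (range (fun p => beta i m p ^+ 2 + betatilde i m p ^+ 2)).

Definition first_coef (c : first_layer_case) (n p : nat) : R :=
  match c with
  | case1 => betatilde 1 n p
  | case2 => beta 1 n p + betatilde 1 n p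
  end.

Definition ahat (c : first_layer_case) (n : nat) : R :=
  sup (range (fun p => first_coef c n p ^+ 2)) + eta_prod 1 n ^+ 2.

Definition ahat_last (c : first_layer_case) (m : nat) : R :=
  sup (range (fun p => first_coef c m p ^+ 2)).

Definition bhat (c : first_layer_case) (m : nat) (alpha : R) : R :=
  sup (range (fun p => (first_coef c m p - 2 ^+ m * (1 - alpha)) ^+ 2)).

(* These equations determine theta on {1, ..., m}. *)
Definition theta_rec (c : first_layer_case) (m : nat) (theta : nat -> R)
    : Prop :=
  (forall n, (1 <= n < m)%N ->
     theta n = Num.sqrt (ahat c n) +
       \sum_(2 <= i < n.+1) theta i.-1 * Num.sqrt (a_coef i n)) /\
  theta m = Num.sqrt (ahat_last c m) +
    \sum_(2 <= i < m.+1) theta i.-1 * Num.sqrt (abar i m).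

End Coefficients.

(* Main.v *)
Require Import Defs.
From HB Require Import structures.
From mathcomp Require Import all_boot all_order all_algebra.
From mathcomp Require Import all_classical all_reals all_analysis.
From mathcomp Require Import ring lra.

Set Implicit Arguments.
Unset Strict Implicit.
Unset Printing Implicit Defensive.

Import Order.TTheory GRing.Theory Num.Theory.
Import numFieldNormedType.Exports.

Local Open Scope classical_set_scope.
Local Open Scope ring_scope.

(* Each proximity operator is firmly nonexpansive, R_n = (Id + N_n) / 2 with N_n
   nonexpansive, and so is Q_n for the Hilbertian norm of the product. For two
   inputs x and y let om_n be 2^(n-1) times the difference of the two vectors
   fed to the n-th activation. Then om_(n+1) = U_(n+1) (om_n + e_n) with
   |e_n| <= |om_n|, so that
     om_n = U_n ... U_2 om_1 + sum_(1 <= i < n) U_n ... U_(i+1) e_i.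
   The products U_n ... U_i are block diagonal in the basis v, with 2 x 2 blocks
   [[beta, betatilde], [0, eta]], whence their norms sqrt a_(i,n), and by
   induction |om_n| <= theta_n |x - y|. Finally 2^m (S x - S y) = om_m + e_m,
   whose distance to 2^m (1 - alpha) (x - y) is at most
   (sqrt bhat + (theta_m - sqrt ahat_m) + theta_m) |x - y|. *)

(** * Inner products *)

Section InnerProduct.
Variables (R : realType) (H : hilbertType R).
Implicit Types (x y z : H) (a : R).

Lemma innerC x y : inner x y = inner y x.
Proof. by rewrite [LHS]hermitian_subproof /= expr0 mul1r. Qed.

Lemma innerZr a x y : inner x (a *: y) = a * inner x y.
Proof. by rewrite linearZr_LR. Qed.

Lemma innerZl a x y : inner (a *: x) y = a * inner x y.
Proof. by rewrite innerC innerZr innerC. Qed.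

Lemma innerDr x y z : inner x (y + z) = inner x y + inner x z.
Proof. exact: linearDr. Qed.

Lemma innerDl x y z : inner (x + y) z = inner x z + inner y z.
Proof. by rewrite !(innerC _ z) innerDr. Qed.

Lemma innerBr x y z : inner x (y - z) = inner x y - inner x z.
Proof. exact: linearBr. Qed.

Lemma innerBl x y z : inner (x - y) z = inner x z - inner y z.
Proof. by rewrite !(innerC _ z) innerBr. Qed.

Lemma normD_sqr x y : `|x + y| ^+ 2 = `|x| ^+ 2 + 2 * inner x y + `|y| ^+ 2.
Proof. by rewrite !sqr_norm_inner innerDl !innerDr (innerC y x); ring. Qed.

Lemma normB_sqr x y : `|x - y| ^+ 2 = `|x| ^+ 2 - 2 * inner x y + `|y| ^+ 2.
Proof. by rewrite normD_sqr linearNr normrN mulrN. Qed.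

Lemma normZ_sqr a x : `|a *: x| ^+ 2 = a ^+ 2 * `|x| ^+ 2.
Proof. by rewrite normrZ exprMn real_normK ?num_real. Qed.

(** Cauchy-Schwarz: expand the squared norm of [|y| *: x - |x| *: y] and divide by [|x| * |y|]. *)
Lemma inner_normM x y : inner x y <= `|x| * `|y|.
Proof.
have [->|y0] := eqVneq y 0; first by rewrite linear0r normr0 mulr0.
have [->|x0] := eqVneq x 0; first by rewrite linear0l normr0 mul0r.
have := sqr_ge0 `| `|y| *: x - `|x| *: y |.
rewrite normB_sqr !normZ_sqr innerZl innerZr => h.
have hp : 0 < `|x| * `|y| by rewrite mulr_gt0 ?normr_gt0.
rewrite -(ler_pM2l hp); nra.
Qed.

Lemma inner_ext x y : (forall z, inner z x = inner z y) -> x = y.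
Proof.
move=> h; apply/eqP; rewrite -subr_eq0 -normr_eq0 -sqrf_eq0 sqr_norm_inner.
by rewrite innerBr h subrr.
Qed.

End InnerProduct.

(** * Proximity operators *)

Section ProximityOperator.
Variables (R : realType) (H : hilbertType R).
Implicit Types (f : H -> \bar R) (x y z : H).

(** Lower semicontinuity gives [f > f x0 - 1] on a ball of radius [r]. For a farther point,
    convexity applied at distance [r / 2] from [x0] on the segment to that point shows that [f]
    falls at most linearly, with slope [2 / r]. *)
Lemma convex_lsc_minorant f :
  proper_fun f -> lower_semicontinuous f -> convex_fun f ->
  exists x0 (a b : R), 0 <= b /\ forall y, ((a - b * `|y - x0|)%:E <= f y)%E.
Proof.
move=> [fNy [x0 fx0]] flsc fconv.
have [s fs] : exists s : R, f x0 = s%:E.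
  by move: (fNy x0) fx0; case: (f x0) => // s _ _; exists s.
have /flsc [V /nbhs_ballP[r /= r0 rV] fV] : ((s - 1)%:E < f x0)%E.
  by rewrite fs lte_fin; lra.
exists x0, (s - 1), (r / 2)^-1; split; first by rewrite invr_ge0; lra.
move=> y; set d := `|y - x0|.
have d0 : 0 <= d by exact: normr_ge0.
have rd0 : 0 <= (r / 2)^-1 * d by rewrite mulr_ge0// invr_ge0; lra.
have [dr|rd] := ltP d r.
  have /rV/fV : ball x0 r y by rewrite -ball_normE /= distrC.
  by move=> /ltW; apply: le_trans; rewrite lee_fin; lra.
have dpos : 0 < d by lra.
set t := r / 2 / d.
have t01 : 0 < t < 1.
  apply/andP; split; first by rewrite divr_gt0//; lra.
  by rewrite ltr_pdivrMr//; lra.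
have /fV : V (t *: y + (1 - t) *: x0).
  apply: rV; rewrite -ball_normE /= distrC.
  have -> : t *: y + (1 - t) *: x0 - x0 = t *: (y - x0).
    rewrite scalerBl scale1r scalerBr -addrA; congr (_ + _).
    by rewrite addrAC subrr sub0r.
  rewrite normrZ gtr0_norm -/d; last by case/andP: t01.
  by rewrite mulfVK ?gt_eqF//; lra.
move=> /lt_le_trans /(_ (fconv y x0 t t01)).
move: (fNy y); case: (f y) => [u _|_ _|//]; last by rewrite leey.
rewrite fs -!EFinM -EFinD lte_fin lee_fin => h.
have tV : (r / 2)^-1 * d = t^-1 by rewrite /t [RHS]invfM invrK.
have [t0 t1] := andP t01; rewrite tV.
have : -1 < t * (u - s) by lra.
rewrite mulrC -ltr_pdivrMr// mulN1r; lra.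
Qed.

(** Parallelogram identity, with the midpoint in the form that [convex_fun] produces. *)
Lemma mid_normB_sqr x y z :
  `|x - (2^-1 *: y + (1 - 2^-1) *: z)| ^+ 2 =
  2^-1 * `|x - y| ^+ 2 + 2^-1 * `|x - z| ^+ 2 - 4^-1 * `|y - z| ^+ 2.
Proof.
have -> : x - (2^-1 *: y + (1 - 2^-1) *: z) =
    2^-1 *: ((x - y) + (x - z)).
  rewrite (_ : 1 - 2^-1 = 2^-1); last by field.
  rewrite -scalerDr [(x - y) + _]addrACA -opprD scalerBr; congr (_ - _).
  by rewrite -mulr2n -[x *+ 2]scaler_nat scalerA mulVf ?scale1r.
have -> : y - z = (x - z) - (x - y) by rewrite opprB addrCA addrAC subrr sub0r.
by rewrite normZ_sqr normD_sqr (normB_sqr (x - z)) (innerC (x - z)); field.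
Qed.

(** Direct method: strong convexity of the quadratic term makes a minimizing sequence Cauchy, and
    lower semicontinuity makes its limit a minimizer. *)
Lemma prox_exists f x :
  proper_fun f -> lower_semicontinuous f -> convex_fun f ->
  exists y, forall z,
    (f y + (2^-1 * `|x - y| ^+ 2)%:E <= f z + (2^-1 * `|x - z| ^+ 2)%:E)%E.
Proof.
move=> fprop flsc fconv.
have [x0 [a [b [b0 fmin]]]] := convex_lsc_minorant fprop flsc fconv.
pose q z := 2^-1 * `|x - z| ^+ 2.
pose h z := (f z + (q z)%:E)%E.
have hinf z : (ereal_inf (range h) <= h z)%E.
  by apply: ereal_inf_lbound; exists z.
have [i hi] : exists i : R, ereal_inf (range h) = i%:E.
  have : (ereal_inf (range h) < +oo)%E.
    case: fprop => fNy [z fz]; apply: le_lt_trans (hinf z) _.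
    by move: (fNy z) fz; rewrite /h; case: (f z) => // s _ _; rewrite ltry.
  (* The quadratic term absorbs the linear decay: [d ^+ 2 / 2 - b * d >= - b ^+ 2 / 2] for
     [d = |x - z|]. *)
  have : ((a - b * `|x - x0| - b ^+ 2 / 2)%:E <= ereal_inf (range h))%E.
    apply/ereal_infP => _ [z _ <-]; rewrite /h.
    apply: le_trans (leeD2r _ (fmin z)); rewrite -EFinD lee_fin /q.
    have : `|z - x0| <= `|x - z| + `|x - x0|.
      have -> : z - x0 = - (x - z) + (x - x0) by rewrite opprB addrA subrK.
      by rewrite (le_trans (ler_normD _ _))// normrN.
    move=> /(ler_wpM2l b0); have := sqr_ge0 (`|x - z| - b); nra.
  by case: ereal_inf => // i _ _; exists i.
rewrite hi in hinf.
have [y hy] : {y : nat -> H &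
    forall n, (h (y n) < (i + n.+1%:R^-1)%:E)%E}.
  apply: (choice (P := fun n y => (h y < (i + n.+1%:R^-1)%:E)%E)) => n.
  have n0 : (0 < n.+1%:R^-1 :> R) by rewrite invr_gt0.
  have : ereal_inf (range h) \is a fin_num by rewrite hi.
  by move=> /(lb_ereal_inf_adherent n0)[_ [y _ <-]]; rewrite hi -EFinD; exists y.
(* At the midpoint [h] is at least [i], and at most the mean of the two values minus one eighth of
   the squared distance. *)
have close n k : `|y n - y k| ^+ 2 <= 4 * (n.+1%:R^-1 + k.+1%:R^-1).
  have half : 0 < (2^-1 : R) < 1 by apply/andP; split; lra.
  have := le_trans (hinf (2^-1 *: y n + (1 - 2^-1) *: y k))
            (leeD2r _ (fconv (y n) (y k) 2^-1 half)).
  move: (hy n) (hy k); rewrite /h.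
  move: (fprop.1 (y n)) (fprop.1 (y k)).
  case: (f (y n)) (f (y k)) => [u||] [w||] // _ _.
  rewrite -!EFinM -!EFinD !lte_fin lee_fin /q mid_normB_sqr.
  by move: n.+1%:R^-1 k.+1%:R^-1 => en ek; lra.
have : cvg (y @ \oo).
  apply/cauchy_cvgP/cauchy_exP => e e0.
  have e2 : 0 < e ^+ 2 / 8 by rewrite divr_gt0// exprn_gt0.
  have [N _ hN] := near_infty_natSinv_lt (PosNum e2).
  exists (y N); exists N => // n /= Nn; rewrite -ball_normE /=.
  rewrite -(@ltr_pXn2r _ 2)// ?nnegrE ?normr_ge0 ?(ltW e0)//.
  apply: le_lt_trans (close _ _) _.
  have := hN n Nn; have := hN N (leqnn _); rewrite /=.
  by move: n.+1%:R^-1 N.+1%:R^-1 => en eN; lra.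
move=> /cvg_ex[p yp]; exists p => z.
suff : (h p <= i%:E)%E by move=> /le_trans; apply; exact: hinf.
rewrite leNgt; apply/negP => ip.
(* A real level below [f p] serves both finite and infinite [f p]. *)
have [c [ic cp]] : exists c : R, i - q p < c /\ (c%:E < f p)%E.
  move: ip; rewrite /h; move: (fprop.1 p); case: (f p) => // [u _|_ _].
    rewrite -EFinD lte_fin => iu; exists ((i - q p + u) / 2).
    by rewrite lte_fin; split; lra.
  by exists (i - q p + 1); rewrite ltry; split => //; lra.
have [V Vp fV] := flsc _ _ cp.
(* Half of the gap: for large [n], [h (y n) > c + q p - e = i + e], which exceeds
   [i + n.+1%:R^-1]. *)
set e := (c + q p - i) / 2.
have e0 : 0 < e by rewrite /e; lra.
have qy : q (y n) @[n --> \oo] --> q p.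
  apply: cvgMr; rewrite expr2; under eq_fun do rewrite expr2.
  by apply: cvgM; apply: cvg_norm; apply: cvgB => //; exact: cvg_cst.
have nV : \forall n \near \oo, V (y n) by exact: yp Vp.
have nq : \forall n \near \oo, `|q p - q (y n)| < e by move/cvgrPdist_lt: qy; apply.
have ne := near_infty_natSinv_lt (PosNum e0).
have [n [[n1 n2] n3]] : exists n, (V (y n) /\ `|q p - q (y n)| < e) /\ n.+1%:R^-1 < e.
  by near \oo => n; exists n; do !split; near: n.
move: (hy n) (fV _ n1); rewrite /h; move: (fprop.1 (y n)).
case: (f (y n)) => // u _; rewrite -EFinD !lte_fin.
by move: n2 n3; rewrite ltr_norml /e => /andP[]; move: n.+1%:R^-1 => en; lra.
Unshelve. all: by end_near.
Qed.

Lemma prox_spec f x z :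
  proper_fun f -> lower_semicontinuous f -> convex_fun f ->
  (f (prox f x) + (2^-1 * `|x - prox f x| ^+ 2)%:E <=
   f z + (2^-1 * `|x - z| ^+ 2)%:E)%E.
Proof.
move=> fprop flsc fconv; have [y hy] := prox_exists x fprop flsc fconv.
by rewrite /prox; case: xgetP => [y' _ /(_ z) //|/(_ y)]; case.
Qed.

Lemma prox_fin f x :
  proper_fun f -> lower_semicontinuous f -> convex_fun f ->
  exists u : R, f (prox f x) = u%:E.
Proof.
move=> fprop flsc fconv; have [fNy [z fz]] := fprop.
have := prox_spec x z fprop flsc fconv.
move: (fNy z) (fNy (prox f x)) fz.
case: (f z) => // s _; case: (f (prox f x)) => // u _ _ _; by exists u.
Qed.

(** This says that [x - prox f x] is a subgradient of [f] at [prox f x]: minimality is tested along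
    the segment towards [z]. *)
Lemma prox_variational f x z (u w : R) :
  proper_fun f -> lower_semicontinuous f -> convex_fun f ->
  f (prox f x) = u%:E -> f z = w%:E -> u + inner (x - prox f x) (z - prox f x) <= w.
Proof.
move=> fprop flsc fconv; set p := prox f x => fp fz.
rewrite leNgt; apply/negP => hlt.
pose g := u + inner (x - p) (z - p) - w; pose n := `|z - p| ^+ 2.
have g0 : 0 < g by rewrite /g; lra.
have n0 : 0 <= n by exact: sqr_ge0.
(* An explicit small [t] replaces a limit: minimality yields [g <= t * n / 2], while
   [t * n <= g]. *)
pose t := g / (n + 2 * g).
have t01 : 0 < t < 1.
  apply/andP; split; first by rewrite divr_gt0//; lra.
  by rewrite ltr_pdivrMr; lra.
have [t0 t1] := andP t01.
have tn : t * n <= g.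
  by rewrite /t mulrAC ler_pdivrMr; [nra|lra].
have := leeD2r (2^-1 * `|x - (t *: z + (1 - t) *: p)| ^+ 2)%:E
            (fconv z p t t01).
move=> /(le_trans (prox_spec x _ fprop flsc fconv)); rewrite -/p fp fz.
have -> : x - (t *: z + (1 - t) *: p) = (x - p) - t *: (z - p).
  rewrite scalerBl scale1r scalerBr -[RHS]addrA -opprD; congr (x - _).
  by rewrite addrCA.
rewrite -!EFinM -!EFinD lee_fin (normB_sqr (x - p)) normZ_sqr innerZr -/n.
rewrite /g in tn g0 *; nra.
Qed.

(** Adding the two variational inequalities gives firm nonexpansiveness,
    [|p - q| ^+ 2 <= inner (x - y) (p - q)]; expanding the square turns it into this bound. *)
Lemma prox_reflection_nonexpansive f x y :
  proper_fun f -> lower_semicontinuous f -> convex_fun f ->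
  `|2 *: (prox f x - prox f y) - (x - y)| <= `|x - y|.
Proof.
move=> fprop flsc fconv.
have [u fx] := prox_fin x fprop flsc fconv.
have [w fy] := prox_fin y fprop flsc fconv.
have hx := prox_variational fprop flsc fconv fx fy.
have hy := prox_variational fprop flsc fconv fy fx.
move: hx hy; set p := prox f x; set q := prox f y => hx hy.
rewrite -(@ler_pXn2r _ 2) ?nnegrE ?normr_ge0//.
rewrite (normB_sqr (2 *: _)) normZ_sqr innerZl sqr_norm_inner.
move: hx hy; rewrite !(innerBl, innerBr) (innerC q p) (innerC p x) (innerC q x).
rewrite (innerC p y) (innerC q y); lra.
Qed.

End ProximityOperator.

(** * Adjoints and diagonal operators *)

Section Adjoint.
Variables (R : realType) (H K : hilbertType R).

Lemma compact_operator_bounded (A : {linear H -> K}) :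
  compact_operator A -> bounded_operator A.
Proof.
have b1 : bounded_set [set x : H | `|x| <= 1].
  by exists 1; split => // M M1 x /= /le_trans; apply; exact: ltW.
(* Boundedness gives every number strictly above [M] as a bound, whence [M + 1]. *)
move=> /(_ _ b1)[U AU [/compact_bounded[M [_ UM]] _]]; exists (M + 1) => x.
have [->|x0] := eqVneq x 0; first by rewrite linear0 !normr0 mulr0.
have xgt0 : 0 < `|x| by rewrite normr_gt0.
have /AU/(UM (M + 1)) : (A @` [set x | `|x| <= 1]) (A (`|x|^-1 *: x)).
  by exists (`|x|^-1 *: x) => //=; rewrite normrZ normfV normr_id mulVf ?gt_eqF.
rewrite /= linearZ normrZ normfV normr_id ler_pdivrMl// mulrC.
by apply; rewrite ltrDl.
Qed.

Lemma bounded_operator_gt0 (A : H -> K) : bounded_operator A ->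
  exists2 M, 0 < M & forall x, `|A x| <= M * `|x|.
Proof.
move=> [M AM]; exists (`|M| + 1); first by rewrite ltr_wpDl.
move=> x; apply: le_trans (AM x) _; apply: ler_wpM2r => //.
by rewrite (le_trans (ler_norm M))// lerDl.
Qed.

(* Riesz representation: the representer of [z |-> inner (A z) y] is the
   proximity operator of the opposite functional at 0. *)
Lemma inner_adjoint (A : {linear H -> K}) (z : H) (y : K) :
  bounded_operator A -> inner (A z) y = inner z (adjoint A y).
Proof.
move=> /bounded_operator_gt0[M M0 AM].
suff [x hx] : exists x, forall z, inner (A z) y = inner z x.
  by rewrite /adjoint; case: xgetP => [x' _ /(_ z)//|/(_ x)]; case.
pose f (z : H) : \bar R := (- inner (A z) y)%:E.
have fprop : proper_fun f by split => //; exists 0; rewrite ltry.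
have flsc : lower_semicontinuous f.
  move=> x a; rewrite lte_fin => ax.
  have c0 : 0 < M * `|y| + 1 by rewrite ltr_wpDl// mulr_ge0// ltW.
  pose d := (- inner (A x) y - a) / (M * `|y| + 1).
  have d0 : 0 < d by rewrite divr_gt0// subr_gt0.
  exists (ball x d); first exact: nbhsx_ballx.
  move=> w; rewrite -ball_normE /= distrC => xw; rewrite lte_fin.
  have : inner (A (w - x)) y <= `|w - x| * (M * `|y| + 1).
    apply: le_trans (inner_normM _ _) _.
    have := ler_wpM2r (normr_ge0 y) (AM (w - x)).
    by have := normr_ge0 (w - x); lra.
  rewrite linearB innerBl; move: xw; rewrite /d ltr_pdivlMr//; lra.
have fconv : convex_fun f.
  move=> x w t _; rewrite /f linearD !linearZ innerDl !innerZl.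
  by rewrite -!EFinM -EFinD lee_fin; lra.
have [p hp] := prox_exists 0 fprop flsc fconv; exists p => w.
(* Comparing [p] with [p - (e * s) *: w] gives [e ^+ 2 * s <= (e ^+ 2 * s) * (s * |w| ^+ 2) / 2]. As
   [s * |w| ^+ 2 <= 1], the defect [e] vanishes. *)
pose e := inner w p - inner (A w) y; pose s := (`|w| ^+ 2 + 1)^-1.
have n0 : 0 <= `|w| ^+ 2 by exact: sqr_ge0.
have s0 : 0 < s by rewrite invr_gt0 ltr_wpDl.
have sn : s * `|w| ^+ 2 <= 1.
  by rewrite mulrC ler_pdivrMr ?ltr_wpDl// mul1r lerDl.
have := hp (p + (- e * s) *: w).
rewrite -!EFinD lee_fin !sub0r !normrN normD_sqr normZ_sqr innerZr linearD linearZ.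
rewrite innerDl innerZl (innerC p w) => h.
have e0 : e ^+ 2 * s <= 2^-1 * (e ^+ 2 * s) * (s * `|w| ^+ 2).
  by move: h; rewrite /e; lra.
have e2 : 0 <= e ^+ 2 by exact: sqr_ge0.
have es : 0 <= e ^+ 2 * s by rewrite mulr_ge0// ltW.
have es0 : e ^+ 2 * s <= 0.
  by have := ler_wpM2l es sn; rewrite mulr1; lra.
have : e ^+ 2 == 0 by rewrite eq_le e2 andbT -(pmulr_lle0 _ s0).
by rewrite sqrf_eq0 subr_eq0 => /eqP.
Qed.

End Adjoint.

Section DiagonalOperators.
Variables (R : realType) (H : hilbertType R) (v : nat -> H).
Implicit Types (A B : H -> H) (s t : nat -> R).

(** Linearity is an equation here because the operators built from [adjoint] are plain functions,
    not bundled linear maps. *)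
Definition diagonal s A := [/\ forall a x y, A (a *: x + y) = a *: A x + A y,
  bounded_operator A & forall p, A (v p) = s p *: v p].

Lemma diagonal0 : diagonal (fun=> 0) (fun=> 0).
Proof.
split=> [a x y|| p]; rewrite ?scaler0 ?addr0 ?scale0r//.
by exists 0 => x; rewrite normr0 mul0r.
Qed.

Lemma diagonal_id : diagonal (fun=> 1) id.
Proof. by split=> // [|p]; [exists 1 => x; rewrite mul1r|rewrite scale1r]. Qed.

Lemma diagonalD s t A B : diagonal s A -> diagonal t B ->
  diagonal (fun p => s p + t p) (fun x => A x + B x).
Proof.
move=> [Al [M AM] Av] [Bl [N BN] Bv]; split=> [a x y||p].
- by rewrite Al Bl scalerDr addrACA.
- exists (M + N) => x; rewrite mulrDl; apply: le_trans (ler_normD _ _) _.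
  exact: lerD.
- by rewrite Av Bv scalerDl.
Qed.

Lemma diagonalZ s A c : diagonal s A ->
  diagonal (fun p => c * s p) (fun x => c *: A x).
Proof.
move=> [Al [M AM] Av]; split=> [a x y||p].
- by rewrite Al scalerDr !scalerA mulrC.
- by exists (`|c| * M) => x; rewrite normrZ -mulrA ler_wpM2l.
- by rewrite Av scalerA.
Qed.

Lemma diagonal_comp s t A B : diagonal s A -> diagonal t B ->
  diagonal (fun p => s p * t p) (A \o B).
Proof.
move=> [Al Ab Av] [Bl [N BN] Bv]; have [M M0 AM] := bounded_operator_gt0 Ab.
have A0 : A 0 = 0 by have := Al (-1) 0 0; rewrite scaler0 addr0 scaleN1r addNr.
split=> [a x y||p] /=.
- by rewrite Bl Al.
- exists (M * N) => x /=; apply: le_trans (AM _) _.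
  by rewrite -mulrA ler_wpM2l// ltW.
- by rewrite Bv -[t p *: _]addr0 Al A0 addr0 Av scalerA mulrC.
Qed.

(** For the bound, [w = adjoint A (A x)] satisfies [|w| ^+ 2 = inner (A w) (A x) <= M ^+ 2 * |w| *
    |x|]. *)
Lemma diagonal_adjoint (K : hilbertType R) (A : {linear H -> K}) s :
  bounded_operator A -> (forall p, adjoint A (A (v p)) = s p *: v p) ->
  diagonal s (fun x => adjoint A (A x)).
Proof.
move=> Ab Av; split => // [a x y|].
  apply: inner_ext => z; rewrite innerDr innerZr -!inner_adjoint//.
  by rewrite linearP innerDr innerZr.
have [M M0 AM] := bounded_operator_gt0 Ab; exists (M ^+ 2) => x.
set w := adjoint A (A x).
have [->|w0] := eqVneq w 0; first by rewrite normr0 mulr_ge0// sqr_ge0.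
rewrite -(@ler_pM2l _ `|w|) ?normr_gt0// -expr2 sqr_norm_inner.
rewrite -[inner w w](inner_adjoint w (A x) Ab) (le_trans (inner_normM _ _))//.
apply: le_trans (ler_pM _ _ (AM w) (AM x)) _ => //.
by rewrite expr2 mulrACA mulrCA.
Qed.

Lemma diagonal_continuous s A : diagonal s A -> continuous A.
Proof.
move=> [Al /bounded_operator_gt0[M M0 AM] _] x.
apply/cvgrPdist_lt => e e0.
have : \forall y \near x, `|x - y| < e / M.
  by apply/nbhs_ballP; exists (e / M) => /=; rewrite ?divr_gt0// -ball_normE.
apply: filterS => y xy.
have -> : A x - A y = A (x - y).
  by rewrite addrC -scaleN1r -Al scaleN1r addrC.
by rewrite (le_lt_trans (AM _))// mulrC -ltr_pdivlMr.
Qed.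

Lemma diagonal_sum s A n (c : nat -> R) : diagonal s A ->
  A (\sum_(p < n) c p *: v p) = \sum_(p < n) (s p * c p) *: v p.
Proof.
move=> [Al _ Av].
have A0 : A 0 = 0 by have := Al (-1) 0 0; rewrite scaler0 addr0 scaleN1r addNr.
elim: n => [|n IHn]; first by rewrite !big_ord0.
by rewrite !big_ord_recr/= addrC Al IHn Av scalerA addrC mulrC.
Qed.

Hypothesis hv : orthonormal_basis v.

Lemma norm_sqr_span n (c : nat -> R) :
  `|\sum_(p < n) c p *: v p| ^+ 2 = \sum_(p < n) c p ^+ 2.
Proof.
elim: n => [|n IHn]; first by rewrite !big_ord0 normr0 expr0n.
rewrite !big_ord_recr/= normD_sqr IHn normZ_sqr innerC.
have -> : inner (c n *: v n) (\sum_(p < n) c p *: v p) = 0.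
  rewrite linear_sumr big1// => p _.
  by rewrite /= innerZr innerZl hv.1 gtn_eqF ?mulr0.
by rewrite mulr0 addr0 sqr_norm_inner hv.1 eqxx mulr1.
Qed.

Lemma diagonal_bounded_symbol s A : diagonal s A ->
  exists2 M, 0 < M & forall p, `|s p| <= M.
Proof.
move=> [_ /bounded_operator_gt0[M M0 AM] Av]; exists M => // p.
have v1 : `|v p| = 1.
  by apply/eqP; rewrite -(@eqrXn2 _ 2)// sqr_norm_inner hv.1 eqxx expr1n.
by have := AM (v p); rewrite Av normrZ v1 !mulr1.
Qed.

(** Otherwise the open set where [f] is positive would meet the dense span. *)
Lemma le0_closure_span (f : H -> R) : continuous f ->
  (forall n (c : nat -> R), f (\sum_(p < n) c p *: v p) <= 0) -> forall x, f x <= 0.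
Proof.
move=> fcont fspan x; rewrite leNgt; apply/negP => fx.
have fopen : open (f @^-1` [set y | 0 < y]).
  by apply: open_comp => [? _|]; [exact: fcont|exact: open_gt].
have [|y [/= fy [n [c yE]]]] := hv.2 _ _ fopen; first by exists x.
by move: fy; rewrite yE ltNge fspan.
Qed.

(** Transfers a scalar inequality, valid at each index [p], to vectors: on finite combinations of
    the basis it is summed over [p] by Pythagoras, and density gives the rest. The number [e] is the
    squared second eigenvalue, or 0 when only the first component is measured. *)
Lemma diagonal_pair_bound s t A B (e k : R) x y :
  diagonal s A -> diagonal t B ->
  (forall p a b, (s p * a + t p * b) ^+ 2 + e * b ^+ 2 <=
    k * (a ^+ 2 + b ^+ 2)) ->
  `|A x + B y| ^+ 2 + e * `|y| ^+ 2 <= k * (`|x| ^+ 2 + `|y| ^+ 2).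
Proof.
move=> sA tB hk; rewrite -subr_le0.
have Ac := diagonal_continuous sA; have Bc := diagonal_continuous tB.
have ncont (f : H -> H) : continuous f -> continuous (fun x => `|f x| ^+ 2).
  move=> fc z; rewrite /continuous_at expr2; under eq_fun do rewrite expr2.
  by apply: cvgM; apply: cvg_norm; exact: fc.
have idc : continuous (@id H) by move=> ?; exact: cvg_id.
pose f x y := `|A x + B y| ^+ 2 + e * `|y| ^+ 2 - k * (`|x| ^+ 2 + `|y| ^+ 2).
(* Density is used first in [y] with [x] arbitrary, then in [x] with [y] in the span. *)
rewrite -/(f x y); apply: (le0_closure_span (f := f x)) => [|n d].
  move=> z; rewrite /f; apply: cvgB; first apply: cvgD.
  - by apply: (ncont (fun z => A x + B z)) => w; apply: cvgD; [exact: cvg_cst|exact: Bc].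
  - by apply: cvgMr; exact: (ncont id).
  - by apply: cvgMr; apply: cvgD; [exact: cvg_cst|exact: (ncont id)].
apply: (le0_closure_span (f := fun x => f x _)) => [|n' c] {x y}.
  move=> z; rewrite /f; apply: cvgB; first apply: cvgD.
  - by apply: (ncont (fun z => A z + _)) => w; apply: cvgD; [exact: Ac|exact: cvg_cst].
  - exact: cvg_cst.
  - by apply: cvgMr; apply: cvgD; [exact: (ncont id)|exact: cvg_cst].
(* Padding with zeros gives both combinations the same length. *)
have pad (u : nat -> R) (i j : nat) : (i <= j)%N ->
    exists w : nat -> R, \sum_(p < i) u p *: v p = \sum_(p < j) w p *: v p.
  move=> ij; exists (fun p => if (p < i)%N then u p else 0).
  rewrite (big_ord_widen j (fun p => u p *: v p))// big_mkcond /=.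
  by apply: eq_bigr => p _; case: ifP => // _; rewrite scale0r.
have [{}d ->] := pad d _ _ (leq_maxl n n').
have [{}c ->] := pad c _ _ (leq_maxr n n').
rewrite /f (diagonal_sum _ _ sA) (diagonal_sum _ _ tB) -big_split /=.
under eq_bigr do rewrite -scalerDl.
rewrite (norm_sqr_span _ (fun p => s p * c p + t p * d p)) !norm_sqr_span.
rewrite subr_le0 !mulr_sumr -!big_split /= mulr_sumr.
by apply: ler_sum => p _; exact: hk.
Qed.

End DiagonalOperators.

(** * Norm bounds *)

Section PairNorm.
Variables (R : realType) (H : hilbertType R).
Implicit Types z w : H * H.

(* The Hilbertian norm on the product, as opposed to the sup norm carried by
   the library instance on [H * H]. *)
Definition pair_norm z := Num.sqrt (`|z.1| ^+ 2 + `|z.2| ^+ 2).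

Lemma pair_norm_ge0 z : 0 <= pair_norm z.
Proof. exact: sqrtr_ge0. Qed.

Lemma sqr_pair_norm z : pair_norm z ^+ 2 = `|z.1| ^+ 2 + `|z.2| ^+ 2.
Proof. by rewrite sqr_sqrtr// addr_ge0// sqr_ge0. Qed.

Lemma le_pair_norm z a : 0 <= a ->
  `|z.1| ^+ 2 + `|z.2| ^+ 2 <= a ^+ 2 -> pair_norm z <= a.
Proof. by move=> a0; rewrite -sqr_pair_norm ler_pXn2r ?nnegrE ?pair_norm_ge0. Qed.

Lemma pair_normD z w : pair_norm (z + w) <= pair_norm z + pair_norm w.
Proof.
apply: le_pair_norm; first by rewrite addr_ge0 ?pair_norm_ge0.
rewrite !normD_sqr sqrrD !sqr_pair_norm.
suff : inner z.1 w.1 + inner z.2 w.2 <= pair_norm z * pair_norm w by lra.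
apply: le_trans (lerD (inner_normM _ _) (inner_normM _ _)) _.
rewrite -(@ler_pXn2r _ 2) ?nnegrE ?addr_ge0 ?mulr_ge0 ?pair_norm_ge0//.
rewrite exprMn !sqr_pair_norm.
have := sqr_ge0 (`|z.1| * `|w.2| - `|z.2| * `|w.1|); lra.
Qed.

Lemma pair_normZ a z : pair_norm (a *: z) = `|a| * pair_norm z.
Proof.
by rewrite /pair_norm !normZ_sqr -mulrDr sqrtrM ?sqr_ge0// sqrtr_sqr.
Qed.

Lemma pair_norm_sum n (F : 'I_n -> H * H) :
  pair_norm (\sum_(i < n) F i) <= \sum_(i < n) pair_norm (F i).
Proof.
elim/big_ind2: _ => [|x a y b xa yb|//].
  by rewrite /pair_norm !normr0 expr0n addr0 sqrtr0.
by apply: le_trans (pair_normD _ _) (lerD xa yb).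
Qed.

End PairNorm.

(** The factor [k] is the largest eigenvalue of the Gram matrix of [[[b, t], [0, h]]], whose trace
    is [s] and determinant [b ^+ 2 * h ^+ 2]. Subtracting the Gram matrix from [k] times the
    identity leaves diagonal entries [P], [Q] and off-diagonal entry [- b * t], a singular matrix
    with nonnegative trace. *)
Lemma quadratic_form_bound (R : realType) (b t h x y : R)
    (s := b ^+ 2 + t ^+ 2 + h ^+ 2) :
  (b * x + t * y) ^+ 2 + h ^+ 2 * y ^+ 2 <=
  2^-1 * (s + Num.sqrt (s ^+ 2 - 4 * b ^+ 2 * h ^+ 2)) * (x ^+ 2 + y ^+ 2).
Proof.
set r := Num.sqrt _.
have r0 : 0 <= r by exact: sqrtr_ge0.
have disc : r ^+ 2 = s ^+ 2 - 4 * b ^+ 2 * h ^+ 2.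
  rewrite sqr_sqrtr// (_ : _ - _ = (s - 2 * (b * h)) * (s + 2 * (b * h))).
    by apply: mulr_ge0; rewrite /s;
      [have := sqr_ge0 (b - h)|have := sqr_ge0 (b + h)];
      have := sqr_ge0 t; lra.
  by ring.
set k := 2^-1 * (s + r).
pose P := k - b ^+ 2; pose Q := k - t ^+ 2 - h ^+ 2.
have PQ : P * Q = (b * t) ^+ 2.
  have -> : P * Q = (r ^+ 2 - s ^+ 2 + 4 * b ^+ 2 * h ^+ 2) / 4 + (b * t) ^+ 2.
    by rewrite /P /Q /k /s; field.
  by rewrite disc; field.
have PQ0 : 0 <= P + Q.
  by rewrite (_ : P + Q = r)// /P /Q /k /s; field.
have bt0 : 0 <= (b * t) ^+ 2 by exact: sqr_ge0.
(* If [P < 0], then [Q > 0] by [PQ0], so [P * Q < 0], against [PQ]. *)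
have P0 : 0 <= P by rewrite leNgt; apply/negP => P0; nra.
rewrite -subr_ge0 (_ : _ - _ = P * x ^+ 2 - 2 * (b * t) * x * y + Q * y ^+ 2); last first.
  by rewrite /P /Q; ring.
have [P00|Pn0] := eqVneq P 0.
  have /eqP : (b * t) ^+ 2 = 0 by rewrite -PQ P00 mul0r.
  rewrite sqrf_eq0 => /eqP ->; rewrite P00; move: PQ0; rewrite P00 add0r => Q0.
  by have := mulr_ge0 Q0 (sqr_ge0 y); lra.
have Ppos : 0 < P by rewrite lt_def Pn0.
rewrite -(pmulr_rge0 _ Ppos).
rewrite (_ : P * (_ + _) = (P * x - b * t * y) ^+ 2 + (P * Q - (b * t) ^+ 2) * y ^+ 2); last by ring.
by rewrite PQ subrr mul0r addr0 sqr_ge0.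
Qed.

Section SupRange.
Variables (R : realType) (f : nat -> R).

(** The upper bound [c] excludes the default value 0 that [sup] takes on unbounded sets. *)
Lemma le_sup_range c p : (forall q, f q <= c) -> f p <= sup (range f).
Proof.
by move=> fc; apply: ub_le_sup; [exists c => _ [q _ <-]|exists p].
Qed.

Lemma sup_range_sqr_ub a p :
  (forall q, `|f q| <= a) -> f p ^+ 2 <= sup (range (fun q => f q ^+ 2)).
Proof.
move=> fa; apply: (@ub_le_sup _ (range (fun q => f q ^+ 2))); last by exists p.
exists (a ^+ 2) => _ [q _ <-].
by rewrite -[f q ^+ 2]real_normK ?num_real// lerXn2r// nnegrE (le_trans _ (fa q)).
Qed.

End SupRange.

(** * Positive multiples of proper, lower semicontinuous, convex functions *)

Section ScaledFunction.
Variables (R : realType) (H : hilbertType R) (g : H -> \bar R) (a : R).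
Hypothesis a0 : 0 < a.
Local Open Scope ereal_scope.

Lemma proper_funZ : proper_fun g -> proper_fun (fun x => a%:E * g x).
Proof.
move=> [gNy [x gx]]; split => [y|].
  move: (gNy y); case: (g y) => // [_]; by rewrite gt0_muley ?lte_fin.
exists x; move: (gNy x) gx; case: (g x) => // r _ _.
by rewrite -EFinM ltry.
Qed.

Lemma lower_semicontinuousZ :
  lower_semicontinuous g -> lower_semicontinuous (fun x => a%:E * g x).
Proof.
move=> glsc x b.
have ltE e : (b%:E < a%:E * e) = ((b / a)%:E < e).
  case: e => [r||].
  - by rewrite -EFinM !lte_fin ltr_pdivrMr// mulrC.
  - by rewrite gt0_muley ?lte_fin// !ltry.
  - by rewrite gt0_muleNy ?lte_fin// !ltNge !leNye.
rewrite ltE => /glsc[V Vx gV]; exists V => // y /gV.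
by rewrite ltE.
Qed.

Lemma convex_funZ : proper_fun g -> convex_fun g ->
  convex_fun (fun x => a%:E * g x).
Proof.
move=> [gNy _] gconv x y t t01; have [t0 t1] := andP t01.
have t10 : (0 < 1 - t)%R by lra.
apply: le_trans (lee_wpmul2l _ (gconv x y t t01)) _.
  by rewrite lee_fin ltW.
move: (gNy x) (gNy y); case: (g x) => [r||]//; case: (g y) => [s||]// _ _.
- by rewrite -!(EFinM, EFinD) lee_fin; lra.
- by rewrite !gt0_muley ?lte_fin// -!EFinM addey// leey.
- by rewrite !gt0_muley ?lte_fin// -!EFinM addye// leey.
- by rewrite !gt0_muley ?lte_fin// leey.
Qed.

End ScaledFunction.

(** * Products of layers *)

Section Telescoping.
Variables (R : realType) (V : lmodType R) (U : nat -> V -> V).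

(** Here [k] counts the factors: the layers run from [i] to [i + k - 1]. *)
Fixpoint iter_layers i k z := if k is k'.+1 then U (i + k') (iter_layers i k' z) else z.

Lemma iter_layersSr i k z : iter_layers i k.+1 z = iter_layers i.+1 k (U i z).
Proof. by elim: k => [|k IHk] /=; rewrite ?addn0// -IHk addSnnS. Qed.

Hypothesis UD : forall n z w, U n (z + w) = U n z + U n w.

(** Discrete variation of constants: the perturbation [e j] goes through the [k - j] layers numbered
    [j + 2] to [k + 1]. *)
Lemma telescope (om e : nat -> V) :
  (forall k, om k.+1 = U k.+2 (om k + e k)) ->
  forall k, om k = iter_layers 2 k (om 0) +
    \sum_(j < k) iter_layers j.+2 (k - j) (e j).
Proof.
move=> omS; elim=> [|k IHk]; first by rewrite big_ord0 addr0.
have U0 n : U n 0 = 0 by apply: (addrI (U n 0)); rewrite -UD !addr0.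
rewrite omS IHk !UD -addrA /= add2n; congr (_ + _).
rewrite big_ord_recr /= subSnn (big_morph (U k.+2) (UD _) (U0 _)) /= addn0.
congr (_ + _); apply: eq_bigr => j _.
by rewrite subSn 1?ltnW//= addSn addSn subnKC 1?ltnW.
Qed.

End Telescoping.

(** * Block-diagonal form and norms of the products of layers *)

Section Layers.
Variables (R : realType) (X Y Z : hilbertType R).
Variables (T : {linear X -> Y}) (D : {linear X -> Z}).
Variables (lambda tau eta betaT betaD : nat -> R) (v : nat -> X).
Hypothesis Tb : bounded_operator T.
Hypothesis Db : bounded_operator D.
Hypothesis hv : orthonormal_basis v.
Hypothesis hbT : forall p, adjoint T (T (v p)) = betaT p *: v p.
Hypothesis hbD : forall p, adjoint D (D (v p)) = betaD p *: v p.

Local Notation W := (W_layer T D lambda tau).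
Local Notation U := (U_layer T D lambda tau eta).
Local Notation blayer := (beta_layer lambda tau betaT betaD).
Local Notation b := (beta lambda tau betaT betaD).
Local Notation bt := (betatilde lambda tau eta betaT betaD).
Local Notation fc := (first_coef lambda tau eta betaT betaD).
Local Notation Uh := (Uhat1 T D lambda tau eta).

Lemma eq_diagonal s t (A B : X -> X) :
  s =1 t -> A =1 B -> diagonal v s A -> diagonal v t B.
Proof. by move=> /funext -> /funext ->. Qed.

Lemma diagonal_W n : diagonal v (blayer n) (W n).
Proof.
have := diagonalD (diagonalD (diagonal_id v)
    (diagonalZ (- lambda n) (diagonal_adjoint Tb hbT)))
  (diagonalZ (- (lambda n * tau n)) (diagonal_adjoint Db hbD)).
by apply: eq_diagonal => [p|x]; rewrite /W_layer ?scaleNr// /beta_layer; ring.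
Qed.

Lemma W_layerD n x y : W n (x + y) = W n x + W n y.
Proof. by have [Wl _ _] := diagonal_W n; have := Wl 1 x y; rewrite !scale1r. Qed.

Lemma W_layerZ n a x : W n (a *: x) = a *: W n x.
Proof.
have [Wl _ _] := diagonal_W n.
have W0 : W n 0 = 0 by apply: (addrI (W n 0)); rewrite -W_layerD !addr0.
by have := Wl a x 0; rewrite W0 !addr0.
Qed.

Lemma U_layerD n z w : U n (z + w) = U n z + U n w.
Proof.
apply: injective_projections => /=; last by rewrite scalerDr.
by rewrite W_layerD scalerDr addrACA.
Qed.

Lemma U_layerZ n a z : U n (a *: z) = a *: U n z.
Proof.
apply: injective_projections => /=; last by rewrite !scalerA mulrC.
by rewrite W_layerZ [RHS]scalerDr; congr (_ + _); rewrite !scalerA mulrC.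
Qed.

Lemma betaS i n p : (i <= n.+1)%N -> b i n.+1 p = blayer n.+1 p * b i n p.
Proof. by move=> ?; rewrite /beta big_nat_recr//= mulrC. Qed.

Lemma eta_prodS i n : (i <= n.+1)%N ->
  eta_prod eta i n.+1 = eta n.+1 * eta_prod eta i n.
Proof. by move=> ?; rewrite /eta_prod big_nat_recr//= mulrC. Qed.

(** Upper right entry of the product of the block [[[blayer, lambda], [0, eta]]] of layer [n.+1]
    with the block of layers [i] to [n]. *)
Lemma betatildeS i n p : (i <= n)%N ->
  bt i n.+1 p = blayer n.+1 p * bt i n p + lambda n.+1 * eta_prod eta i n.
Proof.
move=> lein; rewrite /betatilde big_nat_recr//=; congr (_ + _).
rewrite big_nat1 mulrDr mulr_sumr mulrA; congr (_ + _).
apply: eq_big_nat => j /andP[_ jn].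
rewrite big_nat_recr ?leqW//=; ring.
Qed.

Lemma iter_layers_diagonal i k : (0 < i)%N -> exists A B,
  [/\ diagonal v (b i (i + k)) A, diagonal v (bt i (i + k)) B & forall z,
    iter_layers U i k.+1 z = (A z.1 + B z.2, eta_prod eta i (i + k) *: z.2)].
Proof.
move=> i0; elim: k => [|k [A [B [Ad Bd AB]]]].
  exists (W i), (fun x => lambda i *: x); rewrite addn0; split.
  - by apply: eq_diagonal (diagonal_W i) => // p; rewrite /beta big_nat1.
  - apply: eq_diagonal (diagonalZ (lambda i) (diagonal_id v)) => // p.
    (* Since [0 < i], the product [eta_prod eta i i.-1] is empty and equals 1. *)
    by rewrite /betatilde /eta_prod prednK// !big_geq// add0r.
  - by move=> z; rewrite /= addn0 /eta_prod big_nat1.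
exists (W (i + k.+1) \o A).
exists (fun x => W (i + k.+1) (B x) +
  (lambda (i + k.+1) * eta_prod eta i (i + k)) *: x); split.
- apply: eq_diagonal (diagonal_comp (diagonal_W _) Ad) => // p.
  by rewrite addnS betaS// leqW// leq_addr.
- have := diagonalD (diagonal_comp (diagonal_W (i + k.+1)) Bd)
    (diagonalZ (lambda (i + k.+1) * eta_prod eta i (i + k)) (diagonal_id v)).
  apply: eq_diagonal => // p.
  by rewrite mulr1 addnS betatildeS// leq_addr.
- move=> z; rewrite -[LHS]/(U (i + k.+1) (iter_layers U i k.+1 z)) AB.
  rewrite /U_layer /= W_layerD -addrA !scalerA; congr (_, _ *: _).
  by rewrite addnS eta_prodS// leqW// leq_addr.
Qed.

(** [Uhat1] is layer 1 applied to [(0, x)] or [(x, x)], so the first component of the product over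
    layers 1 to [k.+1] is [B x] or [A x + B x]. *)
Lemma iter_layers_Uhat c k : exists2 F, diagonal v (fc c k.+1) F &
  forall x, iter_layers U 2 k (Uh c x) = (F x, eta_prod eta 1 k.+1 *: x).
Proof.
have [A [B [Ad Bd AB]]] := iter_layers_diagonal k (ltn0Sn 0).
case: c => /=.
  exists B => // x; rewrite -iter_layersSr AB /=.
  have [Al _ _] := Ad; have := Al (-1) 0 0.
  by rewrite scaler0 addr0 scaleN1r addNr => ->; rewrite add0r.
by exists (fun x => A x + B x) => [|x]; [exact: diagonalD|rewrite -iter_layersSr AB].
Qed.

(** Ensures that the suprema defining [a_coef] and [abar] are finite. *)
Lemma symbol_pair_ub i n : (0 < i <= n)%N ->
  exists2 M, 0 < M & forall p, b i n p ^+ 2 + bt i n p ^+ 2 <= M.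
Proof.
move=> /andP[i0 lein].
have [A [B [Ad Bd _]]] := iter_layers_diagonal (n - i) i0.
rewrite subnKC// in Ad Bd.
have [M M0 AM] := diagonal_bounded_symbol hv Ad.
have [N N0 BN] := diagonal_bounded_symbol hv Bd.
exists (M ^+ 2 + N ^+ 2) => [|p]; first by rewrite addr_gt0// exprn_gt0.
rewrite -(real_normK (num_real (b i n p))) -(real_normK (num_real (bt i n p))).
by rewrite lerD// lerXn2r ?nnegrE ?normr_ge0 ?(ltW M0) ?(ltW N0).
Qed.

Lemma pair_norm_iter_layers i k z : (0 < i)%N ->
  pair_norm (iter_layers U i k.+1 z) <=
  Num.sqrt (a_coef lambda tau eta betaT betaD i (i + k)) * pair_norm z.
Proof.
move=> i0; have [A [B [Ad Bd ->]]] := iter_layers_diagonal k i0.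
set n := (i + k)%N in Ad Bd *; set K := a_coef _ _ _ _ _ _ _.
set h := eta_prod eta i n.
have [M M0 bM] : exists2 M, 0 < M & forall p, b i n p ^+ 2 + bt i n p ^+ 2 <= M.
  by apply: symbol_pair_ub; rewrite i0 leq_addr.
pose s p := b i n p ^+ 2 + bt i n p ^+ 2 + h ^+ 2.
have leK p : 2^-1 * (s p + Num.sqrt (s p ^+ 2 - 4 * b i n p ^+ 2 * h ^+ 2)) <= K.
  rewrite /K /a_coef ler_pM2l ?invr_gt0//.
  (* The square root is at most [s q], and [s q <= M + h ^+ 2]. *)
  apply: (@le_sup_range _ (fun p => s p + _) (2 * (M + h ^+ 2))) => q.
  have sM : s q <= M + h ^+ 2 by rewrite /s lerD2r.
  have s0 : 0 <= s q by rewrite /s !addr_ge0 ?sqr_ge0//.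
  suff : Num.sqrt (s q ^+ 2 - 4 * b i n q ^+ 2 * h ^+ 2) <= s q by lra.
  rewrite -[leRHS]ger0_norm// -sqrtr_sqr ler_wsqrtr// lerBlDr lerDl.
  by rewrite mulr_ge0 ?sqr_ge0// mulr_ge0 ?sqr_ge0.
have K0 : 0 <= K.
  by apply: le_trans (leK 0%N); rewrite mulr_ge0 ?invr_ge0// addr_ge0 ?sqrtr_ge0//
    /s !addr_ge0 ?sqr_ge0//.
rewrite /pair_norm -sqrtrM// ler_wsqrtr//= normZ_sqr.
apply: (diagonal_pair_bound hv _ _ Ad Bd) => p x y.
apply: le_trans (quadratic_form_bound _ _ _ _ _) _.
by apply: ler_wpM2r (leK p); rewrite addr_ge0 ?sqr_ge0.
Qed.

(** With the second component dropped ([e = 0]), the scalar inequality is Cauchy-Schwarz in the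
    plane. *)
Lemma fst_iter_layers i k z : (0 < i)%N ->
  `|(iter_layers U i k.+1 z).1| <=
  Num.sqrt (abar lambda tau eta betaT betaD i (i + k)) * pair_norm z.
Proof.
move=> i0; have [A [B [Ad Bd ->]]] := iter_layers_diagonal k i0.
set n := (i + k)%N in Ad Bd *; set K := abar _ _ _ _ _ _ _.
have [M M0 bM] : exists2 M, 0 < M & forall p, b i n p ^+ 2 + bt i n p ^+ 2 <= M.
  by apply: symbol_pair_ub; rewrite i0 leq_addr.
have leK p : b i n p ^+ 2 + bt i n p ^+ 2 <= K.
  exact: (@le_sup_range _ (fun p => b i n p ^+ 2 + bt i n p ^+ 2) M).
have K0 : 0 <= K by apply: le_trans (leK 0%N); rewrite addr_ge0 ?sqr_ge0//.
rewrite -[leLHS]ger0_norm// -sqrtr_sqr /pair_norm -sqrtrM// ler_wsqrtr//=.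
rewrite -[leLHS]addr0 -(mul0r (`|z.2| ^+ 2)).
apply: (diagonal_pair_bound hv _ _ Ad Bd) => p x y; rewrite mul0r addr0.
apply: (@le_trans _ _ ((b i n p ^+ 2 + bt i n p ^+ 2) * (x ^+ 2 + y ^+ 2))).
  have := sqr_ge0 (b i n p * y - bt i n p * x); lra.
by apply: ler_wpM2r (leK p); rewrite addr_ge0 ?sqr_ge0.
Qed.

Lemma diagonal_bound s (A : X -> X) x :
  diagonal v s A -> `|A x| ^+ 2 <= sup (range (fun p => s p ^+ 2)) * `|x| ^+ 2.
Proof.
move=> Ad; have [M M0 sM] := diagonal_bounded_symbol hv Ad.
set K := sup _; have sK p : s p ^+ 2 <= K by exact: sup_range_sqr_ub sM.
have h p (a c : R) : (s p * a + 0 * c) ^+ 2 + 0 * c ^+ 2 <= K * (a ^+ 2 + c ^+ 2).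
  have := ler_wpM2r (sqr_ge0 a) (sK p).
  by have := mulr_ge0 (le_trans (sqr_ge0 _) (sK p)) (sqr_ge0 c); lra.
have := diagonal_pair_bound hv x 0 Ad (diagonal0 v) h.
by rewrite /= normr0 expr0n /= mul0r !addr0.
Qed.

(** For unbounded [s] the supremum is the default value 0. *)
Lemma sup_sqr_ge0 (s : nat -> R) : 0 <= sup (range (fun p => s p ^+ 2)).
Proof.
have [hs|/sup_out ->//] := pselect (has_sup (range (fun p => s p ^+ 2))).
apply: (le_trans (sqr_ge0 (s 0%N))).
by apply: (sup_upper_bound hs); exists 0%N.
Qed.

Lemma pair_norm_iter_layers_Uhat c k x :
  pair_norm (iter_layers U 2 k (Uh c x)) <=
  Num.sqrt (ahat lambda tau eta betaT betaD c k.+1) * `|x|.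
Proof.
have [F Fd ->] := iter_layers_Uhat c k.
have K0 : 0 <= ahat lambda tau eta betaT betaD c k.+1.
  by rewrite /ahat addr_ge0 ?sqr_ge0// sup_sqr_ge0.
rewrite -[X in _ <= _ * X]ger0_norm// -sqrtr_sqr -sqrtrM// ler_wsqrtr//=.
by rewrite normZ_sqr mulrDl lerD2r diagonal_bound.
Qed.

Lemma fst_iter_layers_Uhat c k x :
  `|(iter_layers U 2 k (Uh c x)).1| <=
  Num.sqrt (ahat_last lambda tau eta betaT betaD c k.+1) * `|x|.
Proof.
have [F Fd ->] := iter_layers_Uhat c k; rewrite /=.
rewrite -[X in _ <= _ * X]ger0_norm// -[leLHS]ger0_norm// -!sqrtr_sqr.
by rewrite -sqrtrM ?sup_sqr_ge0// ler_wsqrtr// diagonal_bound.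
Qed.

(** Subtracting a multiple of the identity shifts the eigenvalues, which gives those in [bhat]. *)
Lemma fst_iter_layers_Uhat_sub c k alpha x :
  `|(iter_layers U 2 k (Uh c x)).1 - (2 ^+ k.+1 * (1 - alpha)) *: x| <=
  Num.sqrt (bhat lambda tau eta betaT betaD c k.+1 alpha) * `|x|.
Proof.
have [F Fd ->] := iter_layers_Uhat c k; rewrite /=.
rewrite -[X in _ <= _ * X]ger0_norm// -[leLHS]ger0_norm// -!sqrtr_sqr.
rewrite -sqrtrM ?sup_sqr_ge0// ler_wsqrtr// /bhat.
have := diagonalD Fd (diagonalZ (- (2 ^+ k.+1 * (1 - alpha))) (diagonal_id v)).
move=> /(diagonal_bound x); rewrite scaleNr.
by under eq_fun do rewrite mulr1.
Qed.

End Layers.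

(** * Nonexpansive reflections of the activation layers *)

Section Reflections.
Variables (R : realType) (X : hilbertType R) (g : X -> \bar R).
Variables (lambda mu : nat -> R) (n : nat).
Hypotheses (gprop : proper_fun g) (glsc : lower_semicontinuous g).
Hypotheses (gconv : convex_fun g) (lambda0 : 0 < lambda n) (mu0 : 0 < mu n).

Lemma R_layer_reflection (x y : X) :
  `|2 *: (R_layer g lambda mu n x - R_layer g lambda mu n y) - (x - y)| <= `|x - y|.
Proof.
have lm : 0 < lambda n * mu n by exact: mulr_gt0.
apply: prox_reflection_nonexpansive.
- exact: proper_funZ.
- exact: lower_semicontinuousZ.
- exact: convex_funZ.
Qed.

(** On the second component the reflection is the identity, so only the first one needs an
    estimate. *)
Lemma Q_layer_reflection (z w : X * X) :
  pair_norm (2 *: (Q_layer g lambda mu n z - Q_layer g lambda mu n w) - (z - w)) <=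
  pair_norm (z - w).
Proof.
rewrite /pair_norm ler_wsqrtr// lerD//.
  by rewrite lerXn2r ?nnegrE ?normr_ge0//; exact: R_layer_reflection.
by rewrite /= scaler_nat mulr2n addrK.
Qed.

End Reflections.

(** * Averagedness of the network *)

Theorem proposition3p13 (R : realType) (X Y Z : hilbertType R)
  (phi : X -> R -> R) (psi : Y -> R -> R)
  (hX : function_space phi) (hY : function_space psi)
  (k : R * R -> R) (hk : L2_kernel k)
  (T : {linear X -> Y}) (hT : integral_operator phi psi k T)
  (hTc : compact_operator T)
  (D : {linear X -> Z}) (hD : bounded_operator D)
  (hTD : forall x, adjoint T (T (adjoint D (D x))) =
                   adjoint D (D (adjoint T (T x))))
  (v : nat -> X) (hv : orthonormal_basis v)
  (betaT betaD : nat -> R)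
  (hbT : forall p, adjoint T (T (v p)) = betaT p *: v p)
  (hbD : forall p, adjoint D (D (v p)) = betaD p *: v p)
  (g : X -> \bar R)
  (hgp : proper_fun g) (hgl : lower_semicontinuous g) (hgc : convex_fun g)
  (m : nat) (hm : (2 <= m)%N)
  (lambda mu tau eta : nat -> R)
  (hpos : forall n, (1 <= n <= m)%N ->
     [/\ 0 < lambda n, 0 < mu n, 0 < tau n & 0 < eta n])
  (c : first_layer_case)
  (theta : nat -> R)
  (htheta : theta_rec lambda tau eta betaT betaD c m theta)
  (alpha : R) (halpha : 2^-1 <= alpha <= 1)
  (hcond : Num.sqrt (bhat lambda tau eta betaT betaD c m alpha)
           - Num.sqrt (ahat_last lambda tau eta betaT betaD c m)
           <= 2 ^+ m * alpha - 2 * theta m) :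
  averaged alpha (network T D g lambda mu tau eta c m).

Proof.
have Tb := compact_operator_bounded hTc.
clear phi psi hX hY k hk hT hTc hTD.
case: m hm hpos htheta hcond => [//|[//|M]] _ hpos [thetaE thetam] hcond.
have hR n : (n <= M.+1)%N -> 0 < lambda n.+1 /\ 0 < mu n.+1.
  by move=> nM; have [] := hpos n.+1 nM.
set U := U_layer T D lambda tau eta.
set Uh := Uhat1 T D lambda tau eta c.
set Q := Q_layer g lambda mu.
have UD : forall n z w, U n (z + w) = U n z + U n w.
  exact: (U_layerD lambda tau eta Tb hD hbT hbD).
have UZ : forall n a z, U n (a *: z) = a *: U n z.
  exact: (U_layerZ lambda tau eta Tb hD hbT hbD).
have UB n z w : U n (z - w) = U n z - U n w by rewrite -scaleN1r UD UZ scaleN1r.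
have UhB x y : Uh (x - y) = Uh x - Uh y.
  rewrite /Uh /Uhat1 -/U; case: (c); rewrite -UB; congr (U 1%N _).
  by apply: injective_projections; rewrite /= ?subr0.
(* Indices are shifted by one: [pre x k] is fed to the activation [k + 1], and [st x k] is its
   output. *)
pose st x k := foldl (fun z n => Q n (U n z)) (Q 1%N (Uh x)) (iota 2 k).
pose pre x k := if k is k'.+1 then U k.+1 (st x k') else Uh x.
have stE x k : st x k = Q k.+1 (pre x k).
  case: k => [//|k]; have -> : st x k.+1 = Q k.+2 (U k.+2 (st x k)) => //.
  by rewrite /st -[iota 2 _]/(iota 2 k.+1) -(addn1 k) iotaD foldl_cat /= add2n addn1.
(* [Ubar] is the first component of [U_layer], so the last layer fits the same recursion. *)
have netE x : network T D g lambda mu tau eta c M.+2 x =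
    R_layer g lambda mu M.+2 (pre x M.+1).1.
  by rewrite /network /pre /st subSS subn1.
have main x y : `|2 ^+ M.+2 *: (network T D g lambda mu tau eta c M.+2 x -
      network T D g lambda mu tau eta c M.+2 y) -
    (2 ^+ M.+2 * (1 - alpha)) *: (x - y)| <= 2 ^+ M.+2 * alpha * `|x - y|.
  pose om k := 2 ^+ k *: (pre x k - pre y k).
  (* Scaled difference of the values of the reflection of activation [k + 1]. *)
  pose e k := 2 ^+ k.+1 *: (st x k - st y k) - om k.
  have omS k : om k.+1 = U k.+2 (om k + e k).
    by rewrite addrC subrK UZ UB.
  have e_le k : (k <= M.+1)%N -> pair_norm (e k) <= pair_norm (om k).
    move=> kM; have [lk mk] := hR k kM.
    rewrite /e /om exprSr -scalerA -scalerBr !pair_normZ ler_wpM2l// !stE.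
    exact: Q_layer_reflection.
  have om0 : om 0 = Uh (x - y) by rewrite /om expr0 scale1r UhB.
  have omE := telescope UD omS.
  (* Strong induction, as all earlier [e j] contribute; the index [j] is the term [i = j + 2] of
     [theta_rec]. *)
  have om_le k : (k <= M)%N -> pair_norm (om k) <= theta k.+1 * `|x - y|.
    elim/ltn_ind: k => k IHk kM.
    rewrite thetaE// omE om0 mulrDl.
    apply: le_trans (pair_normD _ _) (lerD _ _).
      exact: (pair_norm_iter_layers_Uhat lambda tau eta Tb hD hv hbT hbD).
    rewrite (big_addn 0 k.+2 2) subSS subSS subn0 big_mkord mulr_suml.
    apply: le_trans (pair_norm_sum _) (ler_sum _ _) => j _.
    (* The norm bounds are stated for nonempty products, hence the successor form. *)
    have jk : (k - j)%N = (k - j).-1.+1 by rewrite prednK// subn_gt0.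
    rewrite jk.
    apply: le_trans (pair_norm_iter_layers lambda tau eta Tb hD hv hbT hbD _ _ _) _ => //.
    rewrite addn2 /= (_ : j.+2 + (k - j).-1 = k.+1)%N; last first.
      by rewrite addSnnS -jk addSn subnKC// ltnW.
    rewrite mulrC mulrAC ler_wpM2r ?sqrtr_ge0//.
    have jM : (j <= M)%N by apply: leq_trans kM; rewrite ltnW.
    by apply: le_trans (e_le _ (leqW jM)) _; exact: IHk.
  pose S := \sum_(2 <= i < M.+3) theta i.-1 *
    Num.sqrt (abar lambda tau eta betaT betaD i M.+2).
  have om_sub : `|(om M.+1).1 - (iter_layers U 2 M.+1 (om 0)).1| <= S * `|x - y|.
    rewrite omE addrC addKr /S (big_addn 0 M.+3 2) subSS subSS subn0 big_mkord mulr_suml.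
    rewrite (big_morph fst (fun _ _ => erefl) erefl).
    apply: le_trans (ler_norm_sum _ _ _) (ler_sum _ _) => j _.
    have jk : (M.+1 - j)%N = (M.+1 - j).-1.+1 by rewrite prednK// subn_gt0.
    rewrite jk.
    apply: le_trans (fst_iter_layers lambda tau eta Tb hD hv hbT hbD _ _ _) _ => //.
    rewrite addn2 /= (_ : j.+2 + (M.+1 - j).-1 = M.+2)%N; last first.
      by rewrite addSnnS -jk addSn subnKC// ltnW.
    rewrite mulrC mulrAC ler_wpM2r ?sqrtr_ge0//.
    have jM : (j <= M)%N by rewrite -ltnS.
    by apply: le_trans (e_le _ (leqW jM)) (om_le _ jM).
  rewrite -/S in thetam.
  have om_last : `|(om M.+1).1| <= theta M.+2 * `|x - y|.
    rewrite -(subrK (iter_layers U 2 M.+1 (om 0)).1 (om M.+1).1) thetam addrC mulrDl.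
    apply: le_trans (ler_normD _ _) (lerD _ om_sub); rewrite om0.
    exact: (fst_iter_layers_Uhat lambda tau eta Tb hD hv hbT hbD).
  pose eps := 2 ^+ M.+2 *: (network T D g lambda mu tau eta c M.+2 x -
      network T D g lambda mu tau eta c M.+2 y) - (om M.+1).1.
  have eps_le : `|eps| <= `|(om M.+1).1|.
    have [lk mk] := hR M.+1 (leqnn _).
    rewrite /eps !netE exprSr -scalerA -scalerBr !normrZ ler_wpM2l//.
    exact: R_layer_reflection.
  have lin := fst_iter_layers_Uhat_sub lambda tau eta Tb hD hv hbT hbD
    c M.+1 alpha (x - y).
  rewrite -/U -/Uh -om0 in lin.
  (* Three pieces: the last reflection, the propagated perturbations, and the deviation of the
     linear part from a multiple of the identity. *)
  have -> : 2 ^+ M.+2 *: (network T D g lambda mu tau eta c M.+2 x -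
      network T D g lambda mu tau eta c M.+2 y) -
    (2 ^+ M.+2 * (1 - alpha)) *: (x - y) =
    eps + ((om M.+1).1 - (iter_layers U 2 M.+1 (om 0)).1) +
    ((iter_layers U 2 M.+1 (om 0)).1 - (2 ^+ M.+2 * (1 - alpha)) *: (x - y)).
    by rewrite [RHS]addrA; congr (_ - _); rewrite -addrA subrK /eps subrK.
  apply: le_trans (ler_normD _ _) _.
  apply: le_trans (lerD (ler_normD _ _) lin) _.
  apply: le_trans (lerD (lerD (le_trans eps_le om_last) om_sub) (lexx _)) _.
  (* The bounds add up to [theta m + S + sqrt bhat] with [S = theta m - sqrt ahat_last], which
     [hcond] compares with [2 ^+ m * alpha]. *)
  rewrite -!mulrDl ler_wpM2r//; move: hcond; rewrite thetam; lra.
have [a0 a1] := andP halpha; have apos : 0 < alpha by lra.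
pose S := network T D g lambda mu tau eta c M.+2.
(* The only possible choice, obtained by solving for [N]; its nonexpansiveness is [main] divided by
   [2 ^+ m * alpha]. *)
exists (fun x => alpha^-1 *: (S x - (1 - alpha) *: x)) => [|x]; last first.
  by rewrite scalerA divff ?gt_eqF// scale1r addrC subrK.
move=> [x y] _ /=; rewrite mul1r -scalerBr normrZ gtr0_norm ?invr_gt0//.
rewrite ler_pdivrMl// -(@ler_pM2l _ (2 ^+ M.+2)) ?exprn_gt0//.
rewrite -{1}(@ger0_norm _ (2 ^+ M.+2)) ?exprn_ge0// -normrZ mulrA.
apply: le_trans (main x y); rewrite -/S -scalerA -scalerBr.
have -> : S x - (1 - alpha) *: x - (S y - (1 - alpha) *: y) =
    S x - S y - (1 - alpha) *: (x - y) => //.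
by rewrite scalerBr !opprD !opprK addrACA.
Qed.
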